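(* Let $(X,\tau,\mathfrak a)$ be an aura topological space. The following are equivalent: (i) the space is aura-$T_1$; (ii) the space is aura-$T_2$; (iii) $\tau_{\mathfrak a}=\mathcal P(X)$; (iv) $\preccurlyeq_{\mathfrak a}$ is equality, i.e. for all $x,y\in X$, $x\preccurlyeq_{\mathfrak a}y\iff x=y$; (v) $\mathfrak a(x)=\{x\}$ for every $x\in X$. In particular, if $(X,\tau,\mathfrak a)$ is aura-$T_1$ then the ambient topology $\tau$ is discrete.
   Context: $X$ is a nonempty set. An aura topological space is a triple $(X,\tau,\mathfrak a)$ where $(X,\tau)$ is a topological space and $\mathfrak a:X\to\tau$ (the scope function) satisfies $x\in\mathfrak a(x)$ for every $x\in X$. A set $U\subseteq X$ is $\mathfrak a$-open (aura-open) if $\{x\in U:\mathfrak a(x)\subseteq U\}=U$; the family of all $\mathfrak a$-open sets is denoted $\tau_{\mathfrak a}$ and is known to be a topology on $X$. The space is aura-$T_i$ if $(X,\tau_{\mathfrak a})$ satisfies the separation axiom $T_i$. The scope relation is $xR_{\mathfrak a}y\iff y\in\mathfrak a(x)$, and $\preccurlyeq_{\mathfrak a}$ is its reflexive-transitive closure. *)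

(* Defs.v *)
From HB Require Import structures.
From mathcomp Require Import all_boot all_classical.
From mathcomp Require Import topology separation_axioms.
From Stdlib Require Import Relation_Operators.

Set Implicit Arguments.
Unset Strict Implicit.
Unset Printing Implicit Defensive.

Local Open Scope classical_set_scope.

Record scope_function (X : topologicalType) := ScopeFunction {
  scope_fun :> X -> set X;
  scope_fun_open : forall x, open (scope_fun x);
  scope_fun_mem : forall x, scope_fun x x
}.

(* An alias of X, so that its canonical topology is that of the aura-open sets
   rather than the ambient one. *)
Definition aura_space (X : topologicalType) (a : scope_function X) : Type := X.

Section Aura.
Context {X : topologicalType} (a : scope_function X).
Implicit Types U V : set X.

Definition aura_open : set_system X :=
  [set U | [set x | U x /\ a x `<=` U] = U].

Lemma aura_openP U : aura_open U <-> forall x, U x -> a x `<=` U.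
Proof.
rewrite /aura_open /=; split=> [E x Ux|sU].
  by move: Ux; rewrite -{1}E => -[].
by apply/seteqP; split=> [x []//|x Ux]; split=> //; exact: sU.
Qed.

Lemma aura_openT : aura_open setT.
Proof. exact/aura_openP. Qed.

Lemma aura_openI : setI_closed aura_open.
Proof.
move=> U V /aura_openP oU /aura_openP oV; apply/aura_openP => x [Ux Vx] y axy.
by split; [exact: oU axy | exact: oV axy].
Qed.

Lemma aura_open_bigcup (I : Type) (f : I -> set X) :
  (forall i, aura_open (f i)) -> aura_open (\bigcup_i f i).
Proof.
move=> of_; apply/aura_openP => x [i _ fix_] y axy; exists i => //.
by have /aura_openP := of_ i; apply; [exact: fix_ | exact: axy].
Qed.

HB.instance Definition _ := Choice.copy (aura_space a) X.
HB.instance Definition _ :=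
  isOpenTopological.Build (aura_space a) aura_openT aura_openI aura_open_bigcup.

Lemma open_auraE : (open : set_system (aura_space a)) = aura_open.
Proof. by []. Qed.

Definition scope_rel (x y : X) : Prop := a x y.

Definition scope_preorder : X -> X -> Prop := @clos_refl_trans X scope_rel.

End Aura.

(* Main.v *)
Require Import Defs.
From mathcomp Require Import all_boot all_classical.
From mathcomp Require Import topology separation_axioms.
From Stdlib Require Import Relation_Operators.

(** A set is aura-open exactly when it is closed upwards under the scope
    relation, so the aura topology is an Alexandrov topology in which the scope
    of [x] lies in every aura-open neighbourhood of [x].  The separation of [x]
    from [y] in the sense of T1 therefore already forces [y] out of the scope of
    [x] ([accessible_scope]): T1 leaves only singleton scopes.  Conversely, with
    singleton scopes every set is aura-open ([aura_open_singleton_scope]), and a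
    discrete topology is Hausdorff.  The order-theoretic condition fits in
    between because upward closure passes from the scope relation to the
    preorder it generates ([aura_open_scope_preorder]), so aura-open singletons
    collapse the preorder to equality.  Finally the scopes are open in the
    ambient topology, so singleton scopes make the ambient topology discrete as
    well. *)

Local Open Scope classical_set_scope.

Section AuraSeparation.
Context {X : topologicalType} (a : scope_function X).

(** A point [y] of the scope of [x] cannot be separated from [x], since every
    aura-open set around [x] swallows the whole scope. *)
Lemma accessible_scope :
  accessible_space (aura_space a) -> forall x, a x = [set x].
Proof.
move=> T1 x; apply/seteqP; split=> [y axy|_ ->]; last exact: scope_fun_mem.
apply: contrapT => /= yx.
have xy : (x : aura_space a) != y by apply/eqP => xy; apply: yx.
have [U [oU xU yU]] := T1 x y xy.
move: xU yU; rewrite !inE => Ux nUy; apply: nUy.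
by move: oU; rewrite open_auraE => /aura_openP; apply; [exact: Ux | exact: axy].
Qed.

Lemma aura_open_singleton_scope :
  (forall x, a x = [set x]) -> aura_open a = [set: set X].
Proof.
move=> a1; apply/seteqP; split=> // U _; apply/aura_openP => x Ux.
by rewrite a1 => _ ->.
Qed.

Lemma aura_discrete_hausdorff :
  aura_open a = [set: set X] -> hausdorff_space (aura_space a).
Proof.
move=> aT; have oA (U : set (aura_space a)) : open U by rewrite open_auraE aT.
move=> x y /(_ [set x] [set y]) [||z [-> //]]; exact: open_nbhs_nbhs.
Qed.

Lemma aura_open_scope_preorder (U : set X) (x y : X) :
  aura_open a U -> scope_preorder a x y -> U x -> U y.
Proof.
move=> /aura_openP oU; elim=> // [u v auv /oU|u v w _ IHuv _ IHvw /IHuv //].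
exact.
Qed.

Lemma ambient_open_singleton_scope :
  (forall x, a x = [set x]) -> (open : set_system X) = [set: set X].
Proof.
move=> a1; apply/seteqP; split=> // U _.
(* Any set is the union of the scopes of its points. *)
have -> : U = \bigcup_(x in U) a x.
  apply/seteqP; split=> [x Ux|x [y Uy]]; first by exists x => //; rewrite a1.
  by rewrite a1 => ->.
by apply: bigcup_open => x _; exact: scope_fun_open.
Qed.

End AuraSeparation.

Theorem theorem6p4 (X : topologicalType) (X0 : [set: X] !=set0)
    (a : scope_function X) :
  [<-> accessible_space (aura_space a);
       hausdorff_space (aura_space a);
       aura_open a = [set: set X];
       forall x y : X, scope_preorder a x y <-> x = y;
       forall x : X, a x = [set x]] /\
  (accessible_space (aura_space a) -> (open : set_system X) = [set: set X]).
Proof.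
split; last by move=> /accessible_scope/ambient_open_singleton_scope.
tfae.
- by move=> /accessible_scope/aura_open_singleton_scope/aura_discrete_hausdorff.
- by move=> /hausdorff_accessible/accessible_scope/aura_open_singleton_scope.
- move=> aT x y; split=> [xy|<-]; last exact: rt_refl.
  have ox : aura_open a [set x] by rewrite aT.
  by have /= -> := aura_open_scope_preorder _ _ _ _ ox xy erefl.
- move=> eqP x; apply/seteqP; split=> [y axy|_ ->]; last exact: scope_fun_mem.
  by apply/esym/eqP; exact: rt_step.
- move=> /aura_open_singleton_scope/aura_discrete_hausdorff.
  exact: hausdorff_accessible.
Qed.
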